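(* Let $U \subseteq T/\{\pm 1\}$ with $|U| \ge 4$ and $1 \in U$ (i.e. $0 \in \arg(U)$), and let $P$ be the collection of projections. Then $R(U)$ is a ring (i.e. a subring of $\mathbb{C}$) if and only if every pairwise product of elementary monomials is a $\mathbb{Z}[P]$-linear combination of elementary monomials.
   Context: $T = \{z \in \mathbb{C} : |z| = 1\}$ is the unit circle, a group under multiplication, and $T/\{\pm 1\}$ is the set of angles: unit complex numbers $\alpha,\beta$ are identified iff $\alpha = \pm\beta$. Elements of $T/\{\pm1\}$ are represented by unit complex numbers $\alpha$ with argument $\arg(\alpha) \in [0,\pi)$, and $\arg(U) = \{\arg(\alpha) : \alpha \in U\}$. For $p \in \mathbb{C}$ and an angle $\alpha$, $L_\alpha(p) = p + \mathbb{R}\alpha$. For distinct angles $\alpha \ne \beta$ in $T/\{\pm1\}$ and $p,q \in \mathbb{C}$, $I_{\alpha,\beta}(p,q)$ is the unique point of $L_\alpha(p) \cap L_\beta(q)$. For $U \subseteq T/\{\pm1\}$, set $S_0 = \{0,1\}$, $S_{n+1} = \{I_{\alpha,\beta}(p,q) : \alpha,\beta \in U,\ \alpha \neq \pm\beta,\ p,q \in S_n\}$ for $n\ge 0$, and $R(U) = \bigcup_{n \ge 0} S_n$. Elementary monomials of $U$ are the points $I_{\alpha,\beta}(0,1)$ with $\alpha \ne \beta$ in $U$. The set of projections (of elementary monomials onto the real axis along angles in $U$) is $P = \{I_{1,\gamma}(0,z) : z \text{ an elementary monomial},\ \gamma \in U,\ \gamma \ne 1\} \subseteq \mathbb{R}$.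 $\mathbb{Z}[P]$ is the subring of $\mathbb{R}$ generated by $P$ (and $1$). A $\mathbb{Z}[P]$-linear combination is a finite sum $\sum c_i z_i$ with $c_i \in \mathbb{Z}[P]$. *)

(* Defs.v *)
From HB Require Import structures.
From mathcomp Require Import all_boot all_order all_algebra.
From mathcomp Require Import generic_quotient.
From mathcomp Require Import all_classical reals.
From mathcomp Require Import complex.
From mathcomp Require Import ring.

Set Implicit Arguments.
Unset Strict Implicit.
Unset Printing Implicit Defensive.

Import Order.TTheory GRing.Theory Num.Theory.
Local Open Scope classical_set_scope.
Local Open Scope ring_scope.
Local Open Scope complex_scope.
Local Open Scope quotient_scope.

Section Angles.
Variable R : realType.

Definition unit_complex := {z : R[i] | `|z| == 1}.

Definition same_angle (a b : unit_complex) : bool :=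
  (val a == val b) || (val a == - val b).

Lemma same_angle_refl : reflexive same_angle.
Proof. by move=> a; rewrite /same_angle eqxx. Qed.

Lemma same_angle_sym : symmetric same_angle.
Proof.
by move=> a b; rewrite /same_angle eq_sym -eqr_oppLR [- _ == _]eq_sym.
Qed.

Lemma same_angle_trans : transitive same_angle.
Proof.
move=> b a c; rewrite /same_angle.
by move=> /orP[] /eqP-> /orP[] /eqP->; rewrite ?opprK eqxx ?orbT.
Qed.

Canonical same_angle_equiv :=
  EquivRel same_angle same_angle_refl same_angle_sym same_angle_trans.

(* The group T/{+1,-1} as a set; only its points are needed. *)
Definition angle := {eq_quot same_angle}.
HB.instance Definition _ := Choice.on angle.
HB.instance Definition _ := EqQuotient.on angle.

Definition unit1 : unit_complex := exist _ 1 (introT eqP (normr1 _)).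
Definition angle1 : angle := \pi_angle unit1.

Definition line (a : angle) (p : R[i]) : set R[i] :=
  [set p + t%:C * val (repr a) | t in [set: R]].

(* The point of the intersection is unique when a != b, see [interE] below;
   the value 0 for a = b is a dummy. *)
Definition inter (a b : angle) (p q : R[i]) : R[i] :=
  xget 0 (line a p `&` line b q).

Fixpoint stage (U : set angle) (n : nat) : set R[i] :=
  if n is m.+1 then
    [set z | exists a b p q,
       [/\ U a /\ U b, a != b, stage U m p /\ stage U m q
         & z = inter a b p q]]
  else [set 0; 1].

Definition origami (U : set angle) : set R[i] := \bigcup_n stage U n.

Definition elementary_monomials (U : set angle) : set R[i] :=
  [set z | exists a b, [/\ U a, U b, a != b & z = inter a b 0 1]].

Definition projections (U : set angle) : set R :=
  [set x | exists z c, [/\ elementary_monomials U z, U c, c != angle1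
                         & x%:C = inter angle1 c 0 z]].

Definition is_subring (A : nzRingType) (S : set A) : Prop :=
  subring_closed [in S].

Definition Zadjoin (A : nzRingType) (G : set A) : set A :=
  smallest (@is_subring A) G.

Definition is_lincomb (K : set R) (M : set R[i]) (z : R[i]) : Prop :=
  exists (n : nat) (c : 'I_n -> R) (m : 'I_n -> R[i]),
    [/\ forall i, K (c i), forall i, M (m i)
      & z = \sum_(i < n) (c i)%:C * m i].

Lemma line_pi (u : unit_complex) (p : R[i]) :
  line (\pi_angle u) p = [set p + t%:C * val u | t in [set: R]].
Proof.
have /orP[/eqP e|/eqP e] : same_angle (repr (\pi_angle u)) u.
- by rewrite -[same_angle _ _]/(same_angle_equiv _ _) -eqmodE reprK.
- by rewrite /line e.
rewrite /line e; apply/seteqP; split=> z [t _ <-]; exists (- t) => //.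
  by rewrite rmorphN mulNr mulrN.
by rewrite rmorphN mulrNN.
Qed.

Lemma inter_unique (a b : angle) (p q : R[i]) :
  a != b -> exists! z, (line a p `&` line b q) z.
Proof.
rewrite -(reprK a) -(reprK b) !line_pi => ab.
have {ab} : ~~ same_angle (repr a) (repr b).
  by apply: contra ab; rewrite -[same_angle _ _]/(same_angle_equiv _ _) -eqmodE.
rewrite /same_angle; case: (repr a) (repr b) => [[a1 a2] /= ha] [[b1 b2] /= hb].
have sq (x y : R) : `|x +i* y| == 1 -> x ^+ 2 + y ^+ 2 = 1.
  rewrite normc_def eq_complex /= eqxx andbT => /eqP h.
  by rewrite -[LHS]sqr_sqrtr ?h ?expr1n // addr_ge0 ?sqr_ge0.
move/sq in ha; move/sq in hb.
pose d := a1 * b2 - a2 * b1; pose k := a1 * b1 + a2 * b2.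
move=> ab; have d0 : d != 0.
  apply: contra ab => /eqP dz.
  have e1 : a1 = k * b1.
    transitivity (k * b1 + b2 * d + a1 * (1 - (b1 ^+ 2 + b2 ^+ 2))).
      by rewrite /k /d; ring.
    by rewrite dz hb subrr !mulr0 !addr0.
  have e2 : a2 = k * b2.
    transitivity (k * b2 - b1 * d + a2 * (1 - (b1 ^+ 2 + b2 ^+ 2))).
      by rewrite /k /d; ring.
    by rewrite dz hb subrr !mulr0 subr0 addr0.
  have : k ^+ 2 == 1.
    by rewrite -ha e1 e2 !exprMn -mulrDr hb mulr1.
  rewrite sqrf_eq1 => /orP[]/eqP k1; rewrite e1 e2 k1.
    by rewrite !mul1r eqxx.
  by apply/orP; right; rewrite !mulN1r; apply/eqP.
case: p q => p1 p2 [q1 q2].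
pose x1 := q1 - p1; pose x2 := q2 - p2.
have tE (t s : R) : p1 + t * a1 = q1 + s * b1 -> p2 + t * a2 = q2 + s * b2 ->
    t = (x1 * b2 - x2 * b1) / d.
  move=> h1 h2; apply: (mulIf d0); rewrite divfK //.
  have -> : t * d = (p1 + t * a1) * b2 - (p2 + t * a2) * b1 - p1 * b2 + p2 * b1.
    by rewrite /d; ring.
  by rewrite h1 h2 /x1 /x2; ring.
pose t := (x1 * b2 - x2 * b1) / d; pose s := (x1 * a2 - x2 * a1) / d.
have mulE (r x y u v : R) :
    (u +i* v) + r%:C * (x +i* y) = (u + r * x) +i* (v + r * y).
  by apply/eqP; rewrite eq_complex /= !mul0r subr0 addr0 !eqxx.
exists ((p1 +i* p2) + t%:C * (a1 +i* a2)); split.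
  split; first by exists t.
  exists s => //; rewrite !mulE; apply/eqP; rewrite eq_complex /=.
  by apply/andP; split; apply/eqP; rewrite /s /t /x1 /x2 /d; field.
move=> z [[t' _ <-] [s' _]]; rewrite !mulE => -[h1 h2].
by rewrite (tE t' s' (esym h1) (esym h2)).
Qed.

Lemma interE (a b : angle) (p q z : R[i]) :
  a != b -> (inter a b p q = z <-> line a p z /\ line b q z).
Proof.
move=> ab; have [w [hw uw]] := inter_unique p q ab.
have -> : inter a b p q = w.
  by rewrite /inter; case: xgetP => [y _ /uw //|/(_ w)].
by split=> [<- //|/uw].
Qed.

End Angles.

(* Main.v *)
(** Projecting along one direction onto another is real-linear and never leaves
    [R(U)].  A point is the sum of its projections onto two directions of [U],
    so it suffices to subtract points lying on one line through 0, and a third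
    direction allows that: [R(U)] is an additive group.

    A projection of an elementary monomial [m] along an angle other than 1
    factors through the real axis, hence is a projection [x] in [P] times an
    elementary monomial; along the angle 1 it is [m - x].  So the
    [Z[P]]-span of the elementary monomials is closed under intersections and
    contains [R(U)].  Conversely, real points [c] of [R(U)] satisfy
    [c m] in [R(U)], because [c m] is the projection of [c] that defines [m]
    out of 1; thus [R(U)] contains [Z[P]] and is exactly that span. *)

Require Import Defs.
From mathcomp Require Import all_boot all_order all_algebra.
From mathcomp Require Import all_classical reals.
From mathcomp Require Import complex.
From mathcomp Require Import ring.

Local Open Scope classical_set_scope.
Local Open Scope card_scope.
Local Open Scope ring_scope.

Import GRing.Theory.
Local Open Scope complex_scope.

(** * Subrings as sets and the subring generated by a set *)

Lemma subring_closed_setP (A : nzRingType) (S : set A) :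
  is_subring S <-> [/\ S 1, forall x y, S x -> S y -> S (x - y)
                       & forall x y, S x -> S y -> S (x * y)].
Proof.
have memP x : (x \in [in S]) <-> S x by split=> [/set_mem|/mem_set].
split=> -[S1 SB SM]; split.
- exact/memP.
- by move=> x y /memP Sx /memP Sy; apply/memP; apply: SB.
- by move=> x y /memP Sx /memP Sy; apply/memP; apply: SM.
- exact/memP.
- by move=> x y /memP Sx /memP Sy; apply/memP; apply: SB.
- by move=> x y /memP Sx /memP Sy; apply/memP; apply: SM.
Qed.

Lemma Zadjoin_subring {A : nzRingType} (G : set A) : is_subring (Zadjoin G).
Proof.
apply/subring_closed_setP; split=> [S [/subring_closed_setP[] //]|x y|x y];
  move=> Gx Gy S [] /[dup] sS /subring_closed_setP[_ SB SM] GS.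
- by apply: SB; [apply: Gx|apply: Gy].
- by apply: SM; [apply: Gx|apply: Gy].
Qed.

Lemma Zadjoin_gen (A : nzRingType) (G : set A) : G `<=` Zadjoin G.
Proof. by move=> x Gx S [_]; apply. Qed.

(** * Linear combinations with real coefficients *)

Section Linear_combinations.
Context {R : realType} (K : set R) (M : set R[i]).

Lemma is_lincomb_gen (c : R) (m : R[i]) : K c -> M m -> is_lincomb K M (c%:C * m).
Proof.
move=> Kc Mm; exists 1%N, (fun=> c), (fun=> m).
by split=> //; rewrite big_ord1.
Qed.

Lemma is_lincombD (z w : R[i]) :
  is_lincomb K M z -> is_lincomb K M w -> is_lincomb K M (z + w).
Proof.
move=> [n [c [m [Kc Mm ->]]]] [n' [c' [m' [Kc' Mm' ->]]]].
exists (n + n')%N,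
  (fun i => match fintype.split i with inl j => c j | inr j => c' j end),
  (fun i => match fintype.split i with inl j => m j | inr j => m' j end).
split=> [i|i|]; try by case: fintype.split.
rewrite big_split_ord /=; congr (_ + _); apply: eq_bigr => i _.
  by rewrite -[lshift _ _]/(unsplit (inl i)) unsplitK.
by rewrite -[rshift _ _]/(unsplit (inr i)) unsplitK.
Qed.

Lemma is_lincomb0 : is_lincomb K M 0.
Proof.
exists 0%N, (fun=> 0), (fun=> 0).
by split=> [[]|[]|] //; rewrite big_ord0.
Qed.

Lemma is_lincomb_sum (n : nat) (F : 'I_n -> R[i]) :
  (forall i, is_lincomb K M (F i)) -> is_lincomb K M (\sum_(i < n) F i).
Proof.
move=> KF; elim/big_ind: _ => //; first exact: is_lincomb0.
exact: is_lincombD.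
Qed.

Lemma is_lincombZ (c : R) (z : R[i]) : is_subring K -> K c ->
  is_lincomb K M z -> is_lincomb K M (c%:C * z).
Proof.
move=> /subring_closed_setP[_ _ KM] Kc [n [d [m [Kd Mm ->]]]].
rewrite mulr_sumr; apply: is_lincomb_sum => i.
by rewrite mulrA -rmorphM; apply: is_lincomb_gen => //; apply: KM.
Qed.

Lemma is_lincombB (z w : R[i]) : is_subring K ->
  is_lincomb K M z -> is_lincomb K M w -> is_lincomb K M (z - w).
Proof.
move=> sK Kz Kw; have [K1 KB _] := (subring_closed_setP _ _).1 sK.
apply: is_lincombD => //.
have K0 : K 0 by rewrite -(subrr 1); apply: KB.
have KN1 : K (- 1) by rewrite -sub0r; apply: KB.
by rewrite -mulN1r -(rmorphN1 (real_complex R)); apply: is_lincombZ.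
Qed.

(** Bilinear expansion reduces a product of combinations to products of generators; the condition on
    pairwise products of monomials enters the theorem here. *)
Lemma is_lincombM : is_subring K ->
  (forall z w, M z -> M w -> is_lincomb K M (z * w)) ->
  forall z w, is_lincomb K M z -> is_lincomb K M w -> is_lincomb K M (z * w).
Proof.
move=> sK MM z w [n [c [m [Kc Mm ->]]]] [n' [c' [m' [Kc' Mm' ->]]]].
rewrite mulr_suml; apply: is_lincomb_sum => i.
rewrite -mulrA; apply: is_lincombZ => //.
rewrite mulr_sumr; apply: is_lincomb_sum => j.
by rewrite mulrCA; apply: is_lincombZ => //; apply: MM.
Qed.

End Linear_combinations.

(** * Intersection of lines as real-linear algebra *)

Section Intersections.
Context {R : realType}.
Implicit Types (a b c : angle R) (p q z w : R[i]).

(** Translating to the parallel line through 0, a real subspace, lets incidence goals be settled by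
    linearity. *)
Lemma lineE a p z : line a p z <-> line a 0 (z - p).
Proof.
split=> -[t _ e]; exists t => //; first by rewrite -e add0r addrC addKr.
by move: e; rewrite add0r => ->; rewrite addrC subrK.
Qed.

Lemma line00 a : line a 0 0.
Proof. by exists 0 => //; rewrite mul0r addr0. Qed.

Lemma line0D a z w : line a 0 z -> line a 0 w -> line a 0 (z + w).
Proof.
move=> [t _ <-] [s _ <-]; exists (t + s) => //.
by rewrite !add0r rmorphD mulrDl.
Qed.

Lemma line0Z a (r : R) z : line a 0 z -> line a 0 (r%:C * z).
Proof.
by move=> [t _ <-]; exists (r * t) => //; rewrite !add0r rmorphM mulrA.
Qed.

Lemma line0N a z : line a 0 z -> line a 0 (- z).
Proof. by rewrite -mulN1r -(rmorphN1 (real_complex R)); apply: line0Z. Qed.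

Lemma line0B a z w : line a 0 z -> line a 0 w -> line a 0 (z - w).
Proof. by move=> az aw; apply: line0D => //; apply: line0N. Qed.

Lemma line_angle1P z : line (angle1 R) 0 z <-> exists r : R, z = r%:C.
Proof.
rewrite /angle1 line_pi; split=> [[t _ <-]|[r ->]].
  by exists t; rewrite add0r mulr1.
by exists r => //; rewrite add0r mulr1.
Qed.

Lemma inter_line0 {a b} p q : a != b ->
  line a 0 (inter a b p q - p) /\ line b 0 (inter a b p q - q).
Proof. by move=> ab; rewrite -!lineE; apply/interE. Qed.

Lemma inter_eq {a b} p q z : a != b ->
  line a 0 (z - p) -> line b 0 (z - q) -> inter a b p q = z.
Proof. by move=> ab; rewrite -!lineE => ? ?; apply/interE. Qed.

(** [inter a b 0 q] is the projection of [q] onto the line of [a] along [b]. *)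
Lemma inter_line a b q : a != b -> line a 0 (inter a b 0 q).
Proof. by move=> /(inter_line0 0 q)[]; rewrite subr0. Qed.

Lemma inter_diag a b p : a != b -> inter a b p p = p.
Proof. by move=> ab; apply: inter_eq; rewrite // subrr; apply: line00. Qed.

(** In the decomposition along [a] and [b], the intersection takes its [a]-component from [q] and
    its [b]-component from [p]. *)
Lemma inter_addE a b p q : a != b ->
  inter a b p q = inter a b 0 q + (p - inter a b 0 p).
Proof.
move=> ab; have [ap bp] := inter_line0 0 p ab.
have [aq bq] := inter_line0 0 q ab; rewrite !subr0 in ap aq.
apply: inter_eq => //.
  by rewrite addrA addrAC addrK; apply: line0B.
by rewrite addrAC -[p - _]opprB; apply: line0B.
Qed.

Lemma interD a b p p' q q' : a != b ->
  inter a b (p + p') (q + q') = inter a b p q + inter a b p' q'.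
Proof.
move=> ab; have [ap bq] := inter_line0 p q ab.
have [ap' bq'] := inter_line0 p' q' ab.
by apply: inter_eq => //; rewrite opprD addrACA; apply: line0D.
Qed.

Lemma interZ a b (r : R) p q : a != b ->
  inter a b (r%:C * p) (r%:C * q) = r%:C * inter a b p q.
Proof.
move=> ab; have [ap bq] := inter_line0 p q ab.
by apply: inter_eq => //; rewrite -mulrBr; apply: line0Z.
Qed.

Lemma inter0Z a b (r : R) q : a != b ->
  inter a b 0 (r%:C * q) = r%:C * inter a b 0 q.
Proof. by move=> ab; rewrite -interZ // mulr0. Qed.

Lemma inter0D a b q q' : a != b ->
  inter a b 0 (q + q') = inter a b 0 q + inter a b 0 q'.
Proof. by move=> ab; rewrite -interD // addr0. Qed.

Lemma inter0_sum a b (n : nat) (F : 'I_n -> R[i]) : a != b ->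
  inter a b 0 (\sum_(i < n) F i) = \sum_(i < n) inter a b 0 (F i).
Proof.
move=> ab; apply: (big_morph _ (fun p q => inter0D a b p q ab)).
exact: inter_diag.
Qed.

(** The two projections are complementary: the components of [q] along [a] and [b] add up to [q]. *)
Lemma interC a b q : a != b -> inter b a 0 q = q - inter a b 0 q.
Proof.
move=> ab; have [aq bq] := inter_line0 0 q ab; rewrite subr0 in aq.
apply: inter_eq; first by rewrite eq_sym.
  by rewrite subr0 -opprB; apply: line0N.
by rewrite addrAC subrr add0r; apply: line0N.
Qed.

End Intersections.

(** * Closure properties of [origami U] and its additive group structure *)

Section Origami.
Context {R : realType} {U : set (angle R)}.
Implicit Types (a b c : angle R) (p q z w : R[i]).

Lemma origami0 : origami U 0. Proof. by exists 0%N => //; left. Qed.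

Lemma origami1 : origami U 1. Proof. by exists 0%N => //; right. Qed.

(** Two lines of different directions through a point meet in that point, so no point is lost at the
    next stage. *)
Lemma stage_succ n a b : U a -> U b -> a != b -> stage U n `<=` stage U n.+1.
Proof.
move=> Ua Ub ab z Sz; exists a, b, z, z.
by split=> //; rewrite inter_diag.
Qed.

Lemma origami_inter a b p q : U a -> U b -> a != b ->
  origami U p -> origami U q -> origami U (inter a b p q).
Proof.
move=> Ua Ub ab [n _ Sp] [m _ Sq].
have mono k l z : stage U k z -> stage U (l + k) z.
  by move=> Sz; elim: l => // l IH; apply: (stage_succ _ _ _ Ua Ub ab).
exists (n + m).+1 => //; exists a, b, p, q.
by split=> //; split; [rewrite addnC|]; apply: mono.
Qed.

Lemma origami_min (S : set R[i]) : S 0 -> S 1 ->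
  (forall a b p q, U a -> U b -> a != b -> S p -> S q -> S (inter a b p q)) ->
  origami U `<=` S.
Proof.
move=> S0 S1 Sinter z [n _]; elim: n z => [z [->|->] //|n IH z].
by move=> [a [b [p [q [[Ua Ub] ab [/IH Sp /IH Sq] ->]]]]]; apply: Sinter.
Qed.

Lemma origami_line0B a b c u v : U a -> U b -> U c ->
  a != b -> a != c -> b != c -> line a 0 u -> line a 0 v ->
  origami U u -> origami U v -> origami U (u - v).
Proof.
move=> Ua Ub Uc ab ac bc au av Su Sv.
have cb : c != b by rewrite eq_sym.
have ba : b != a by rewrite eq_sym.
(* [v + w] is on the line of [c] and [w] on that of [b], so that projecting
   [u + w = (u - v) + (v + w)] along [c] leaves [u - v]. *)
pose x := inter c b 0 v; pose w := x - v.
have cx : line c 0 x by apply: inter_line.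
have bw : line b 0 w by have [] := inter_line0 0 v cb.
have Sx : origami U x by apply: origami_inter => //; apply: origami0.
have Sw : origami U w.
  have -> : w = inter b a 0 x.
    symmetry; apply: inter_eq; rewrite // ?subr0 //.
    by rewrite /w addrAC subrr add0r; apply: line0N.
  by apply: origami_inter => //; apply: origami0.
(* The sum is the fourth vertex of the parallelogram on 0, [u] and [w], whose sides have directions
   [a] and [b]. *)
have Suw : origami U (u + w).
  have <- : inter a b w u = u + w.
    by apply: inter_eq => //; rewrite ?addrK // addrAC subrr add0r.
  exact: origami_inter.
have <- : inter a c 0 (u + w) = u - v.
  apply: inter_eq => //; first by rewrite subr0; apply: line0B.
  have -> : u - v - (u + w) = - x by rewrite /w; ring.
  exact: line0N.
by apply: origami_inter => //; apply: origami0.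
Qed.

Hypothesis U3 : exists a b c, [/\ U a, U b, U c & [&& a != b, a != c & b != c]].

Lemma origamiB z w : origami U z -> origami U w -> origami U (z - w).
Proof.
have [a [b [c [Ua Ub Uc /and3P[ab ac bc]]]]] := U3 => Sz Sw.
have ba : b != a by rewrite eq_sym.
have Sp d e y : U d -> U e -> d != e -> origami U y -> origami U (inter d e 0 y).
  by move=> Ud Ue de Sy; apply: origami_inter => //; apply: origami0.
(* These are the components of [z - w] along [b] and [a]. Each is a difference of points on one line
   through 0, and a single intersection adds them. *)
pose p := inter b a 0 z - inter b a 0 w; pose q := inter a b 0 z - inter a b 0 w.
have <- : inter a b p q = z - w.
  have lp : line b 0 p by apply: line0B; apply: inter_line.
  have lq : line a 0 q by apply: line0B; apply: inter_line.
  have zwE : z - w = p + q.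
    by rewrite /p /q (interC a b z ab) (interC a b w ab); ring.
  by apply: inter_eq => //; rewrite zwE ?addrK // addrAC subrr add0r.
apply: origami_inter => //.
- by apply: (origami_line0B b a c) => //;
    [apply: inter_line|apply: inter_line|apply: Sp|apply: Sp].
- by apply: (origami_line0B a b c) => //;
    [apply: inter_line|apply: inter_line|apply: Sp|apply: Sp].
Qed.

Lemma origamiD z w : origami U z -> origami U w -> origami U (z + w).
Proof.
move=> Sz Sw; rewrite -[w]opprK -[- w]sub0r.
by apply: origamiB => //; apply: origamiB => //; apply: origami0.
Qed.

Lemma elementary_monomial_origami z : elementary_monomials U z -> origami U z.
Proof.
move=> [a [b [Ua Ub ab ->]]].
by apply: origami_inter => //; [apply: origami0|apply: origami1].
Qed.

Lemma origami_real_mul_monomial (r : R) z :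
  origami U r%:C -> elementary_monomials U z -> origami U (r%:C * z).
Proof.
move=> Sr [a [b [Ua Ub ab ->]]]; rewrite -inter0Z // mulr1.
by apply: origami_inter => //; apply: origami0.
Qed.

(** * Comparison of [origami U] with the span of the monomials *)

Hypothesis U1 : U (angle1 R).

Lemma Zadjoin_projections_origami (r : R) :
  Zadjoin (projections U) r -> origami U r%:C.
Proof.
(* Multipliers of the real points of [origami U] are closed under products by composition, so they
   form a subring; applying a multiplier to 1 gives the claim. *)
pose S := [set r : R | forall s : R, origami U s%:C -> origami U (r * s)%:C].
move=> /(_ S) Zr; rewrite -[r]mulr1; apply: Zr; last exact: origami1.
split=> [|x [z [c [Mz Uc c1 xE]]] s Ss].
  apply/subring_closed_setP; split=> [s|x y Sx Sy s Ss|x y Sx Sy s Ss].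
  - by rewrite mul1r.
  - by rewrite mulrBl rmorphB; apply: origamiB; [apply: Sx|apply: Sy].
  - by rewrite -mulrA; apply/Sx/Sy.
(* By homogeneity, [x * s] is the projection onto the real axis of [s] times the monomial [z]. *)
have -> : (x * s)%:C = s%:C * x%:C by rewrite mulrC rmorphM.
rewrite xE -inter0Z; last by rewrite eq_sym.
apply: origami_inter; rewrite // 1?eq_sym //; first exact: origami0.
exact: origami_real_mul_monomial.
Qed.

Let lincomb :=
  is_lincomb (Zadjoin (projections U)) (elementary_monomials U).

Lemma lincomb_origami z : lincomb z -> origami U z.
Proof.
move=> [n [c [m [Zc Mm ->]]]]; elim/big_ind: _ => [|x y|i _].
- exact: origami0.
- exact: origamiD.
- by apply: origami_real_mul_monomial; first exact: Zadjoin_projections_origami.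
Qed.

Lemma elementary_monomial_lincomb z : elementary_monomials U z -> lincomb z.
Proof.
move=> Mz; rewrite -[z]mul1r; apply: is_lincomb_gen => //.
by have /subring_closed_setP[] := Zadjoin_subring (projections U).
Qed.

(** Any line through 1 other than the real axis meets that axis in 1. *)
Lemma elementary_monomial1 : elementary_monomials U 1.
Proof.
have [d [Ud d1]] : exists d, U d /\ angle1 R != d.
  have [a [b [_ [Ua Ub _ /andP[ab _]]]]] := U3.
  have [e|] := eqVneq (angle1 R) a; last by exists a.
  by exists b; rewrite e.
exists (angle1 R), d; split=> //; symmetry; apply: inter_eq => //.
  by rewrite subr0; apply/line_angle1P; exists 1.
by rewrite subrr; apply: line00.
Qed.

Lemma inter_angle1_lincomb b z : U b -> b != angle1 R ->
  elementary_monomials U z ->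
  exists2 r : R, Zadjoin (projections U) r & r%:C = inter (angle1 R) b 0 z.
Proof.
move=> Ub b1 Mz; have /line_angle1P[r rE] :
  line (angle1 R) 0 (inter (angle1 R) b 0 z) by apply: inter_line; rewrite eq_sym.
by exists r => //; apply: Zadjoin_gen; exists z, b.
Qed.

Lemma lincomb_inter0 a b z : U a -> U b -> a != b ->
  lincomb z -> lincomb (inter a b 0 z).
Proof.
move=> Ua Ub ab [n [c [m [Zc Mm ->]]]].
rewrite inter0_sum //; apply: is_lincomb_sum => i; rewrite inter0Z //.
apply: is_lincombZ => //; first exact: Zadjoin_subring.
(* A projection along the real axis is the complement of one onto it, which gives [m i - r]; here
   [r] is a combination because 1 is a monomial. *)
have [b1|b1] := eqVneq b (angle1 R).
  have a1 : a != angle1 R by rewrite -b1.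
  have [r Zr rE] := inter_angle1_lincomb a (m i) Ua a1 (Mm i).
  rewrite b1 (interC (angle1 R) a) -?rE; last by rewrite eq_sym.
  apply: is_lincombB; first exact: Zadjoin_subring.
    exact: elementary_monomial_lincomb.
  by rewrite -[r%:C]mulr1; apply: is_lincomb_gen => //; apply: elementary_monomial1.
have [r Zr rE] := inter_angle1_lincomb b (m i) Ub b1 (Mm i).
(* Projecting along [b] ignores displacements along [b], so [m i] may first be moved to the real
   point [r], which then factors out. *)
have -> : inter a b 0 (m i) = r%:C * inter a b 0 1.
  have [_ bm] : line (angle1 R) 0 (inter (angle1 R) b 0 (m i) - 0) /\
    line b 0 (inter (angle1 R) b 0 (m i) - m i) by apply: inter_line0; rewrite eq_sym.
  rewrite -inter0Z // mulr1.
  have [a0 br] := inter_line0 0 r%:C ab.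
  apply: inter_eq => //; rewrite -rE in bm.
  by rewrite -[X in line b 0 X](subrKA r%:C); apply: line0D.
by apply: is_lincomb_gen => //; exists a, b.
Qed.

Lemma origami_lincombP z : origami U z <-> lincomb z.
Proof.
split; last exact: lincomb_origami; apply: origami_min z.
- exact: is_lincomb0.
- exact/elementary_monomial_lincomb/elementary_monomial1.
(* A general intersection is a sum of two projections, so stability under projections suffices. *)
- move=> a b p q Ua Ub ab lp lq; rewrite inter_addE // -interC //.
  by apply: is_lincombD; apply: lincomb_inter0; rewrite // eq_sym.
Qed.

End Origami.

Theorem theorem3p6 (R : realType) (U : set (angle R))
    (cardU : [set: 'I_4] #<= U) (U1 : U (angle1 R)) :
  is_subring (origami U) <->
  (forall z w : R[i], elementary_monomials U z -> elementary_monomials U w ->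
     is_lincomb (Zadjoin (projections U)) (elementary_monomials U) (z * w)).
Proof.
have U3 : exists a b c, [/\ U a, U b, U c & [&& a != b, a != c & b != c]].
  have /card_leP[f] := cardU.
  (* The cardinality bound gives an injection between sets viewed as subtypes; [g] unwraps it into
     plain angles. *)
  pose g (i : 'I_4) : angle R := set_val (f (SigSub (in_setT i))).
  have gU i : U (g i) by apply: set_valP.
  have gI i j : i != j -> g i != g j.
    apply: contra => /eqP/val_inj/inj h; apply/eqP.
    by have /(congr1 set_val) := h (in_setT _) (in_setT _).
  by exists (g 0), (g 1), (g 2%:R); split=> //; rewrite !gI.
split=> [/subring_closed_setP[_ _ SM] z w Mz Mw|MM].
  by apply/(origami_lincombP U3 U1)/SM; apply: elementary_monomial_origami.
apply/subring_closed_setP; split; [exact: origami1|exact: origamiB|].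
move=> z w /(origami_lincombP U3 U1) lz /(origami_lincombP U3 U1) lw.
apply/(origami_lincombP U3 U1); apply: is_lincombM => //.
exact: Zadjoin_subring.
Qed.
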